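(* Let $X$ be a nonempty finite set and let $(X,P)$ be a poset. Then $\dim(X,P)=n$ if and only if $P$ is $n$-fold. More precisely: A. If $\dim(X,P)=n$, then $P$ is at most $n$-fold (that is, there exists a sequence of recursive partial-conjugates $P_1,\dots,P_m$ with $P_1=P$ and $m\le n$); B. If $P$ is $n$-fold, then $\dim(X,P)\le n$.
   Context: A partial order on a finite nonempty set $X$ is a reflexive, antisymmetric, transitive binary relation on $X$; a linear order is a complete partial order. A poset is a pair $(X,P)$ with $P$ a partial order on $X$. Two elements $x,y$ are ordered (comparable) in $P$ if $xPy$ or $yPx$. The dual $P^d$ of $P$ is defined by $xP^dy$ iff $yPx$. For a binary relation $R$, $T_R$ denotes its transitive closure: $xT_Ry$ iff there are $K\ge1$ and $x_1,\dots,x_K$ with $xRx_1Rx_2\cdots Rx_K=y$. The dimension $\dim(X,P)$ is the smallest number of linear orders on $X$ whose intersection is $P$. Conjugate: two partial orders $P,Q$ on the same set $X$ are conjugate if every two distinct elements of $X$ are ordered in exactly one of $P$, $Q$. Partial-conjugate: for partial orders $P,Q$ on $X$, $Q$ is a partial-conjugate of $P$ if (i) every two distinct elements of $X$ are ordered in at most one of $P$, $Q$; (ii) $P\cup Q$ is a partial order; (iii) $T_{P\cup Q^d}$ is a partial order. Sequence of recursive partial-conjugates: partial orders $P_1,\dots,P_n$ on $X$ form such a sequence if (i) for every $k$ with $2\le k\le n-1$, $P_k$ is a partial-conjugate of $\bigcup_{i=1}^{k-1}P_i$; (ii) $P_n$ is a conjugate of $\bigcup_{i=1}^{n-1}P_i$.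 $n$-fold: a partial order $P$ is $n$-fold if $n$ is the smallest integer such that there exists a sequence of recursive partial-conjugates $P_1,\dots,P_n$ with $P_1=P$. *)

(* Defs.v *)
From mathcomp Require Import all_boot.

Set Implicit Arguments.
Unset Strict Implicit.
Unset Printing Implicit Defensive.

Section Relations.
Variable X : finType.
Implicit Types (P Q R : rel X) (Ps : nat -> rel X) (x y : X) (m n k : nat).

Definition partial_order R : Prop :=
  [/\ reflexive R, antisymmetric R & transitive R].

Definition linear_order R : Prop := partial_order R /\ total R.

Definition ordered_in R x y : bool := R x y || R y x.

Definition dual R : rel X := [rel x y | R y x].

(* connect is the reflexive-transitive closure, so at least one R-step is
   required here; trans_closureP gives the description by chains. *)
Definition trans_closure R : rel X :=
  [rel x y | [exists z, R x z && connect R z y]].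

Lemma trans_closureP R x y :
  reflect (exists p : seq X, [/\ 0 < size p, path R x p & last x p = y])
          (trans_closure R x y).
Proof.
apply: (iffP existsP) => [[z /andP[Rxz /connectP[p Rp ->]]]|].
  by exists (z :: p); split=> //=; rewrite Rxz.
case=> [[|z p] [// _ /= /andP[Rxz Rp] <-]].
by exists z; rewrite Rxz; apply/connectP; exists p.
Qed.

(* The union of the relations Ps i for m <= i < n (empty if n <= m). *)
Definition rel_bigcup m n Ps : rel X :=
  [rel x y | \big[orb/false]_(m <= i < n) Ps i x y].

Definition least (S : nat -> Prop) n : Prop :=
  S n /\ forall m, S m -> n <= m.

(* Realizers are nonempty families: without 0 < n the empty intersection would
   give the one-element poset dimension 0. *)
Definition realizable P n : Prop :=
  0 < n /\ exists L : 'I_n -> rel X,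
    (forall i, linear_order (L i)) /\
    (forall x y, P x y = [forall i, L i x y]).

Definition has_dim P n : Prop := least (realizable P) n.

(* Stated for arbitrary relations, so that it applies to the empty union
   occurring in a sequence of length 1. *)
Definition conjugate P Q : Prop :=
  forall x y, x != y -> ordered_in P x y (+) ordered_in Q x y.

Definition partial_conjugate P Q : Prop :=
  [/\ partial_order P /\ partial_order Q,
      forall x y, x != y -> ~~ (ordered_in P x y && ordered_in Q x y),
      partial_order (relU P Q)
    & partial_order (trans_closure (relU P (dual Q)))].

(* The sequence is Ps 1, ..., Ps n; other values of Ps are irrelevant.  For
   n = 1, the last clause says that Ps 1 is a linear order; for n >= 2, the
   union in it is a partial order by the other clauses. *)
Definition recursive_partial_conjugates n Ps : Prop :=
  [/\ 0 < n,
      forall k, 1 <= k <= n -> partial_order (Ps k),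
      forall k, 2 <= k <= n.-1 ->
        partial_conjugate (rel_bigcup 1 k Ps) (Ps k)
    & conjugate (rel_bigcup 1 n Ps) (Ps n)].

Definition has_rpc_sequence P n : Prop :=
  exists Ps, recursive_partial_conjugates n Ps /\ Ps 1 =2 P.

Definition n_fold P n : Prop := least (has_rpc_sequence P) n.

End Relations.

(* Main.v *)
(** Write [U k] for the union of [Ps 1, ..., Ps k].  Given a sequence of
    recursive partial-conjugates of length [n], [U n] is a linear order and
    [U (k - 1)] is the intersection of [U k] with any linear extension of the
    transitive closure of [U (k - 1)] and the dual of [Ps k]; hence
    [Ps 1 = U 1] is an intersection of [n] linear orders.  Conversely, from a
    realizer [L 1, ..., L n] put [U k = L 1 /\ ... /\ L (n - k + 1)] and let
    [Ps k] be the part of [U k] reversed by [L (n - k + 2)].  So [P] has a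
    realizer of size [n] exactly when it has a sequence of length [n]. *)
Require Import Defs.
From mathcomp Require Import all_boot.
From mathcomp Require Import zify.

Set Implicit Arguments.
Unset Strict Implicit.
Unset Printing Implicit Defensive.

Section RecursivePartialConjugates.
Variable X : finType.
Implicit Types (P Q R U A B L : rel X) (Ps : nat -> rel X).

(** * Partial orders, transitive closures and linear extensions *)

Definition relI P Q : simpl_rel X := [rel x y | P x y && Q x y].

Lemma eq_partial_order P Q : P =2 Q -> partial_order P -> partial_order Q.
Proof.
move=> PQ [Pr Pa Pt]; split=> [x | x y | y x z]; rewrite -!PQ //; first exact: Pa.
exact: Pt.
Qed.

Lemma partial_order_dual P : partial_order P -> partial_order (dual P).
Proof.
move=> [Pr Pa Pt]; split=> [x | x y | y x z]; rewrite /dual //=.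
  by rewrite andbC => /Pa.
by move=> Pyx Pzy; apply: Pt Pzy Pyx.
Qed.

Lemma partial_orderI P Q :
  partial_order P -> partial_order Q -> partial_order (relI P Q).
Proof.
move=> [Pr Pa Pt] [Qr Qa Qt]; split=> [x | x y | y x z] /=.
- by rewrite Pr Qr.
- by case/andP=> /andP[Pxy _] /andP[Pyx _]; apply: Pa; rewrite Pxy.
- case/andP=> Pxy Qxy /andP[Pyz Qyz].
  by rewrite (Pt _ _ _ Pxy Pyz) (Qt _ _ _ Qxy Qyz).
Qed.

Lemma trans_closure_connect R : reflexive R -> trans_closure R =2 connect R.
Proof.
move=> Rr x y; apply/existsP/idP => [[z /andP[/connect1 Rxz]] | Rxy].
  exact: connect_trans.
by exists x; rewrite Rr.
Qed.

Lemma sub_trans_closure R : reflexive R -> subrel R (trans_closure R).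
Proof. by move=> Rr x y Rxy; rewrite trans_closure_connect // connect1. Qed.

(** Every [R]-path stays inside the transitive relation [L], so the closure inherits antisymmetry
    from [L]. This is how the transitive-closure clause of [partial_conjugate] is checked later. *)
Lemma trans_closure_partial_order R L :
  reflexive R -> partial_order L -> subrel R L ->
  partial_order (trans_closure R).
Proof.
move=> Rr [Lr La Lt] RL.
apply: (@eq_partial_order (connect R)) => [x y |].
  by rewrite trans_closure_connect.
have conL x y : connect R x y -> L x y.
  case/connectP=> p Rp ->; elim: p x Rp => //= z p IHp x /andP[/RL Lxz Rp].
  exact: Lt Lxz (IHp _ Rp).
split=> [x | x y /andP[/conL Lxy /conL Lyx] | y x z].
- exact: connect0.
- by apply: La; rewrite Lxy.
- exact: connect_trans.
Qed.

Lemma linear_orderP R :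
  partial_order R -> (forall x y, x != y -> ordered_in R x y) ->
  linear_order R.
Proof.
move=> Rpo Rtot; split=> // x y; have [<-|/Rtot//] := eqVneq x y.
by case: Rpo => ->.
Qed.

(* Sort by the size of the down-set, breaking ties arbitrarily. *)
Lemma linear_extension P :
  partial_order P -> exists2 L, linear_order L & subrel P L.
Proof.
move=> [Pr Pa Pt].
pose f x := #|[set z | P z x]|.
pose g x := f x * #|X| + enum_rank x.
have lt_rank x : enum_rank x < #|X| := ltn_ord (enum_rank x).
have g_inj : injective g.
  move=> x y /(congr1 (modn^~ #|X|)); rewrite !modnMDl !modn_small //.
  by move=> /val_inj/enum_rank_inj.
exists [rel x y | g x <= g y].
  split=> [|x y]; last exact: leq_total.
  split=> [x | x y | y x z] /=; rewrite ?leqnn //; last exact: leq_trans.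
  by rewrite -eqn_leq => /eqP/g_inj.
move=> x y Pxy /=; have [->//|neq_xy] := eqVneq x y.
have lt_f : f x < f y.
  apply/proper_card/properP; split.
    by apply/subsetP=> z; rewrite !inE => Pzx; apply: Pt Pzx Pxy.
  exists y; rewrite inE ?Pr //; apply: contraNN neq_xy => Pyx.
  by apply/eqP/Pa; rewrite Pxy.
rewrite /g; apply: leq_trans (leq_addr _ _).
by apply: leq_trans (leq_mul lt_f (leqnn _)); rewrite mulSn addnC leq_add2r ltnW.
Qed.

(** * Building realizers *)

Lemma eq_realizable P Q n : P =2 Q -> realizable P n -> realizable Q n.
Proof.
by move=> PQ [n0 [L [Llin PL]]]; split=> //; exists L; split=> // x y; rewrite -PQ.
Qed.

Lemma realizable1 L : linear_order L -> realizable L 1.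
Proof.
move=> Llin; split=> //; exists (fun=> L); split=> // x y.
by apply/idP/forallP => [//|]; apply; apply: ord0.
Qed.

Lemma realizableI P n L :
  realizable P n -> linear_order L -> realizable (relI P L) n.+1.
Proof.
move=> [_ [M [Mlin PM]]] Llin; split=> //.
exists (fun i => if unlift ord0 i is Some j then M j else L); split.
  by move=> i; case: unliftP.
move=> x y /=; rewrite PM; apply/andP/forallP.
  by case=> /forallP MP LP i; case: unliftP.
move=> H; split; last by have := H ord0; rewrite unlift_none.
by apply/forallP=> i; have := H (lift ord0 i); rewrite liftK.
Qed.

(** * From sequences of recursive partial-conjugates to realizers *)

Lemma conjugate_linear A B :
  partial_order A -> partial_order B -> conjugate A B ->
  linear_order (relU A B).
Proof.
move=> [Ar Aa At] [Br Ba Bt] AB.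
(* The exclusive half of conjugacy: it collapses every pair ordered by both relations, and so
   settles the mixed cases below. *)
have neqAB x y : ordered_in A x y -> ordered_in B x y -> x = y.
  by move=> Axy Bxy; apply/eqP/contraT => /AB; rewrite Axy Bxy.
have disj x y : A x y -> B x y || B y x -> x = y.
  by move=> Axy; apply: neqAB; rewrite /ordered_in Axy.
have tot x y : x != y -> [|| A x y, B x y, A y x | B y x].
  by move/AB; rewrite /ordered_in; case: (A x y) (A y x) (B x y) => [] [] [].
(* In each mixed case, reversing [x z] would order [x y] or [y z] twice. *)
have mix x y z : A x y -> B y z -> A x z || B x z.
  move=> Axy Byz; have [<-|/tot] := eqVneq x z; first by rewrite Ar.
  case/or4P=> [->//|->|Azx|Bzx]; rewrite ?orbT //.
    have Azy := At _ _ _ Azx Axy.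
    by rewrite (disj _ _ Azy) ?Byz ?orbT // Axy.
  have Byx := Bt _ _ _ Byz Bzx.
  by rewrite (disj _ _ Axy) ?Byx ?orbT // Byz orbT.
have mix' x y z : B x y -> A y z -> A x z || B x z.
  move=> Bxy Ayz; have [<-|/tot] := eqVneq x z; first by rewrite Ar.
  case/or4P=> [->//|->|Azx|Bzx]; rewrite ?orbT //.
    have Ayx := At _ _ _ Ayz Azx.
    by rewrite -(disj _ _ Ayx) ?Bxy ?orbT // Ayz.
  have Bzy := Bt _ _ _ Bzx Bxy.
  by rewrite -(disj _ _ Ayz) ?Bzy ?orbT // Bxy orbT.
apply: linear_orderP => [|x y /tot]; last first.
  by rewrite /ordered_in /= -orbA.
split=> [x | x y | y x z] /=; first by rewrite Ar.
  case/andP=> /orP[] xy /orP[] yx.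
  - by apply: Aa; rewrite xy.
  - by apply: disj; rewrite ?yx ?orbT.
  - by apply/esym/disj; rewrite ?xy ?orbT.
  - by apply: Ba; rewrite xy.
case/orP=> xy /orP[] yz.
- by rewrite (At _ _ _ xy yz).
- exact: mix xy yz.
- exact: mix' xy yz.
- by rewrite (Bt _ _ _ xy yz) orbT.
Qed.

(** Reversing [B] preserves conjugacy, so [A] together with [B] and [A] together with [dual B] are
    both linear; they meet exactly in [A]. This is the base case of the descent in
    [rpc_realizable]. *)
Lemma conjugate_realizable A B :
  partial_order A -> partial_order B -> conjugate A B -> realizable A 2.
Proof.
move=> Apo Bpo AB; have Bdpo := partial_order_dual Bpo.
have ABd : conjugate A (dual B).
  by move=> x y /AB; rewrite /ordered_in /= (orbC (B x y)).
apply: eq_realizable (realizableI (realizable1 (conjugate_linear Apo Bpo AB))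
                                  (conjugate_linear Apo Bdpo ABd)) => x y /=.
(* A pair in both [B] and [dual B] is diagonal, hence already in [A]. *)
rewrite -orb_andr; apply: orb_idr => Bxy; case: Apo Bpo => Ar _ _ [_ Ba _].
by rewrite (Ba _ _ Bxy).
Qed.

(** A linear extension [L] of the closure contains [A] and reverses [B]. Intersecting the union with
    [L] thus removes precisely the off-diagonal pairs of [B], at the cost of one more linear
    order. *)
Lemma partial_conjugate_realizable A B n :
  partial_conjugate A B -> realizable (relU A B) n -> realizable A n.+1.
Proof.
move=> [[[Ar _ _] _] _ _ Tpo] ABn.
have Rr : reflexive (relU A (dual B)) by move=> x /=; rewrite Ar.
have [L Llin TL] := linear_extension Tpo.
apply: eq_realizable (realizableI ABn Llin) => x y /=.
have RL u v : A u v || B v u -> L u v.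
  by move=> Ruv; apply/TL/sub_trans_closure.
apply/andP/idP => [[/orP[//|Bxy] Lxy] | Axy]; last by rewrite RL ?Axy.
case: Llin => -[_ La _] _; rewrite (La x y) ?Ar //.
by rewrite Lxy RL // Bxy orbT.
Qed.

Lemma rel_bigcupS n Ps :
  0 < n -> rel_bigcup 1 n.+1 Ps =2 relU (rel_bigcup 1 n Ps) (Ps n).
Proof. by move=> n0 x y; rewrite /rel_bigcup /= big_nat_recr. Qed.

Lemma rel_bigcup1 Ps : rel_bigcup 1 2 Ps =2 Ps 1.
Proof. by move=> x y; rewrite /rel_bigcup /= big_nat1. Qed.

Lemma rpc_realizable P n : has_rpc_sequence P n -> realizable P n.
Proof.
case=> Ps [[n0 Ppo Ppc Pcj] PsP].
pose U k := rel_bigcup 1 k.+1 Ps.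
have UP : U 1 =2 P by move=> x y; rewrite /U rel_bigcup1.
case: n n0 Ppo Ppc Pcj => [//|[|n]] _ Ppo Ppc Pcj.
  (* Length 1: the empty union orders no pair, so conjugacy says that [Ps 1] is total. *)
  apply: eq_realizable PsP (realizable1 _); apply: linear_orderP; first exact: Ppo.
  by move=> x y /Pcj; rewrite /ordered_in /rel_bigcup /= !big_nil.
have Upo k : 0 < k <= n.+1 -> partial_order (U k).
  case: k => [//|[|k]] /= kn.
    apply: (eq_partial_order (P := Ps 1)); last exact: Ppo.
    by move=> x y; rewrite /U rel_bigcup1.
  have [_ _ H _] := Ppc k.+2 kn; apply: eq_partial_order H.
  by move=> x y; rewrite /U [RHS]rel_bigcupS.
(* The length is now [n.+2]. The descent starts at [U n.+1], which is conjugate to the last term,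
   and each step down adds one linear order, reaching [U 1] at [j = n]. *)
have UR j : j <= n -> realizable (U (n.+1 - j)) j.+2.
  elim: j => [_|j IHj lt_jn].
    rewrite subn0; apply: (@conjugate_realizable _ (Ps n.+2)) => //.
      by apply: Upo; rewrite leqnn.
    by apply: Ppo; rewrite leqnn.
  apply: (@partial_conjugate_realizable _ (Ps (n.+1 - j))).
    have -> : U (n.+1 - j.+1) = rel_bigcup 1 (n.+1 - j) Ps.
      by rewrite /U; congr (rel_bigcup 1 _ Ps); lia.
    by apply: Ppc; lia.
  apply: eq_realizable (IHj (ltnW lt_jn)) => x y.
  rewrite /U rel_bigcupS; last by lia.
  by have -> : (n.+1 - j.+1).+1 = n.+1 - j by lia.
by apply: eq_realizable UP _; have := UR n (leqnn n); rewrite subSnn.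
Qed.

(** * From realizers to sequences of recursive partial-conjugates *)

(** One linear order [L] cuts [U] into the part [A] it agrees with and the part [B] it reverses.
    Totality of [L] makes them cover [U], and [L] contains both [A] and [dual B], which bounds the
    closure. *)
Lemma split_partial_conjugate U L A B :
  partial_order U -> linear_order L ->
  A =2 relI U L -> B =2 relI U (dual L) ->
  [/\ partial_order B, partial_conjugate A B, relU A B =2 U
    & linear_order U -> conjugate A B].
Proof.
move=> Upo [Lpo Ltot] AE BE.
have Apo : partial_order A.
  by apply: eq_partial_order (partial_orderI Upo Lpo) => x y; rewrite AE.
have Bpo : partial_order B.
  apply: eq_partial_order (partial_orderI Upo (partial_order_dual Lpo)) => x y.
  by rewrite BE.
have ABU : relU A B =2 U.
  by move=> x y /=; rewrite AE BE /= -andb_orr Ltot andbT.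
have disj x y : x != y -> ~~ (ordered_in A x y && ordered_in B x y).
  case: Upo Lpo => _ Ua _ [_ La _]; apply: contra; rewrite /ordered_in !AE !BE /dual /=.
  (* In each case either [U] or [L] orders the pair both ways. *)
  case/andP=> /orP[] /andP[Uxy Lxy] /orP[] /andP[Uyx Lyx]; apply/eqP.
  - by apply: La; rewrite Lxy.
  - by apply: Ua; rewrite Uxy.
  - by apply: Ua; rewrite Uyx.
  - by apply: La; rewrite Lyx.
split=> //; last first.
  case=> _ Utot x y /disj; have := Utot x y; rewrite -!ABU /ordered_in /=.
  by case: (A x y) (A y x) (B x y) (B y x) => [] [] [] [].
split=> //; first by apply: eq_partial_order Upo => x y; rewrite ABU.
apply: (trans_closure_partial_order (L := L)) => //.
  by case: Apo => Ar _ _ x /=; rewrite Ar.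
by move=> x y; rewrite /dual /= AE BE => /orP[] /andP[].
Qed.

Lemma realizable_rpc P n : realizable P n -> has_rpc_sequence P n.
Proof.
case: n => [[]//|m] [_ [L [Llin PL]]].
(* With the realizer indexed from 0, [U k] is the intersection of [L 0, ..., L (m + 1 - k)]: all of
   them for [k = 1], only [L 0] for [k = m.+1]. *)
pose U k := [rel x y | [forall i : 'I_m.+1, (i + k <= m.+1) ==> L i x y]].
(* For [k >= 2], [m.+2 - k] is the index dropped on passing from [U k.-1] to [U k]; it is at most
   [m], so [inord] does not fall back to its default. *)
pose Ps k := if k <= 1 then U 1 else relI (U k) (dual (L (inord (m.+2 - k)))).
have Upo k : 0 < k <= m.+1 -> partial_order (U k).
  case/andP=> k0 km; split=> [x | x y | y x z] /=.
  - by apply/forallP=> i; apply/implyP=> _; case: (Llin i) => -[->].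
  - case/andP=> /forallP/(_ ord0)/implyP/(_ km) Lxy.
    move=> /forallP/(_ ord0)/implyP/(_ km) Lyx.
    by case: (Llin ord0) => -[_ La _] _; apply: La; rewrite Lxy.
  - move=> /forallP Uxy /forallP Uyz; apply/forallP=> i; apply/implyP=> ik.
    case: (Llin i) => -[_ _ Lt] _.
    exact: Lt (implyP (Uxy i) ik) (implyP (Uyz i) ik).
have UP : U 1 =2 P.
  move=> x y; rewrite PL /=; apply: eq_forallb => i.
  by rewrite addn1 ltn_ord.
have Ulin : linear_order (U m.+1).
  split=> [|x y]; first by apply: Upo; rewrite leqnn.
  have UL u v : U m.+1 u v = L ord0 u v.
    apply/forallP/idP => [/(_ ord0)/implyP/(_ (leqnn _))// | Luv i].
    apply/implyP=> im; have -> // : i = ord0.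
    by apply: val_inj => /=; lia.
  by case: (Llin ord0) => _ /(_ x y); rewrite -!UL.
have UI k : 0 < k <= m -> U k =2 relI (U k.+1) (L (inord (m.+2 - k.+1))).
  move=> km x y; have jE : @inord m (m.+2 - k.+1) = m.+2 - k.+1 :> nat.
    by rewrite inordK //; lia.
  apply/forallP/andP => [H | [/forallP H Lxy] i].
    split; last by apply: (implyP (H _)); rewrite jE; lia.
    by apply/forallP=> i; apply/implyP=> ik; apply: (implyP (H _)); lia.
  apply/implyP=> ik; have [i_eq|i_neq] := eqVneq i (inord (m.+2 - k.+1)).
    by rewrite i_eq.
  apply: (implyP (H i)); suff : (i : nat) <> m.+2 - k.+1 by lia.
  by rewrite -jE => /val_inj/eqP; rewrite (negPf i_neq).
(* [A] is kept general because it is used both as [U k] and as the union of the first terms, which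
   agree only pointwise. *)
have spl k A : 0 < k <= m -> A =2 U k ->
    [/\ partial_order (Ps k.+1), partial_conjugate A (Ps k.+1),
        relU A (Ps k.+1) =2 U k.+1
      & linear_order (U k.+1) -> conjugate A (Ps k.+1)].
  move=> km AU; apply: (@split_partial_conjugate _ (L (inord (m.+2 - k.+1)))) => //.
  - by apply: Upo; lia.
  - by move=> x y; rewrite AU UI.
  - by case: k km {AU} => [//|k].
have bigU k : 0 < k <= m.+1 -> rel_bigcup 1 k.+1 Ps =2 U k.
  elim: k => [//|[_ _ x y|k IHk km x y]]; first by rewrite rel_bigcup1.
  rewrite rel_bigcupS //; have [||_ _ -> _] // := spl k.+1 (rel_bigcup 1 k.+2 Ps).
  by apply: IHk; lia.
exists Ps; split; last exact: UP.
split=> // [[|[|k]] // km | [|[|k]] // km |].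
- exact: Upo.
- by case: (spl k.+1 (U k.+1) km (fun _ _ => erefl)).
- have km' : 0 < k.+1 <= m by lia.
  by case: (spl _ _ km' (bigU k.+1 _)) => //; lia.
(* For [m = 0] the sequence has length 1 and conjugacy with the empty union is totality of [U 1]. *)
- have [m0|m0] := posnP m.
    subst m => x y _; rewrite /ordered_in /rel_bigcup /= !big_nil.
    by case: Ulin => _; apply.
  have mm : 0 < m <= m by rewrite m0 leqnn.
  by case: (spl _ _ mm (bigU m _)) => [|_ _ _ /(_ Ulin)] //; lia.
Qed.

End RecursivePartialConjugates.

Lemma least_iff (S T : nat -> Prop) n :
  (forall m, S m <-> T m) -> least S n <-> least T n.
Proof.
move=> ST; split=> -[Sn Smin]; split=> [|m /ST]; try exact: Smin; exact/ST.
Qed.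

Theorem theorem1 (X : finType) (hX : 0 < #|X|) (P : rel X)
    (hP : partial_order P) :
  [/\ forall n : nat, has_dim P n <-> n_fold P n,
      forall n : nat, has_dim P n ->
        exists2 m : nat, m <= n & has_rpc_sequence P m
    & forall n : nat, n_fold P n ->
        exists2 m : nat, m <= n & has_dim P m].
Proof.
have dimE n : has_dim P n <-> n_fold P n.
  by apply: least_iff => m; split; [apply: realizable_rpc | apply: rpc_realizable].
split=> // n; first by case=> /realizable_rpc Pn _; exists n.
by move=> /dimE Pn; exists n.
Qed.
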